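(* Fix $m>0$, $\beta>0$ and let $\beta_n=\vartheta(n)\beta$, where $\vartheta(n)>0$ satisfies $\lim_{n\to\infty}\vartheta(n)/n=\infty$. Then for every $\epsilon>0$, $$\lim_{n\to\infty}\mu^n_{\beta_n,m}\big(\mathcal H_n(\psi_n)\le E_0^n(m)+\epsilon\big)=1 .$$
   Context: Let $\widetilde{\mathbb T}_n=\{1,\dots,n\}$ with periodic identification $0\equiv n$. For $\psi\in\mathbb C^n$ define $$\mathcal H_n(\psi)=\frac1n\sum_{x\in\widetilde{\mathbb T}_n}\frac{n^2}{2}|\psi(x)-\psi(x-1)|^2-\frac1{4n}\sum_{x\in\widetilde{\mathbb T}_n}|\psi(x)|^4,\qquad \mathcal M_n(\psi)=\frac1n\sum_{x\in\widetilde{\mathbb T}_n}|\psi(x)|^2,$$ $S_m^n=\{\psi\in\mathbb C^n:\mathcal M_n(\psi)=m\}$ (a real $(2n-1)$-dimensional sphere), $\mu_m^n$ the uniform probability measure on $S_m^n$, and $E_0^n(m)=\inf\{\mathcal H_n(\psi):\psi\in S_m^n\}$. For $b>0$ the canonical Gibbs measure at inverse temperature $b$ is the probability measure $d\mu^n_{b,m}=Z_n(b,m)^{-1}e^{-b\mathcal H_n(\psi)}d\mu_m^n$ on $S_m^n$, with $Z_n(b,m)=\int_{S_m^n}e^{-b\mathcal H_n}d\mu_m^n$. *)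

(* Defs.v *)
From HB Require Import structures.
From mathcomp Require Import all_boot all_order all_algebra.
From mathcomp Require Import all_classical all_reals all_analysis.
From mathcomp Require Import measurable_realfun.
From mathcomp Require Import complex.
Import Order.TTheory GRing.Theory Num.Theory.
Import numFieldNormedType.Exports.
Import ComplexField.Normc.

Set Implicit Arguments.
Unset Strict Implicit.
Unset Printing Implicit Defensive.

Local Open Scope classical_set_scope.
Local Open Scope complex_scope.
Local Open Scope ring_scope.

Section complex_measurable.
Variable R : realType.

HB.instance Definition _ := isPointed.Build R[i] 0.

(* lebesgue_measure is a measure on measurableTypeR R, whose display differs
   from that of R *)
Let mR := measurableTypeR R.

Definition complex_pair (z : R[i]) : mR * mR := (complex.Re z, complex.Im z).

Definition pair_complex (p : mR * mR) : R[i] := p.1 +i* p.2.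

(* The Borel sigma-algebra of R[i] = R * R *)
Definition complex_measurable : set (set R[i]) :=
  preimage_set_system [set: R[i]] complex_pair measurable.

Let sigma_algebra_complex : sigma_algebra [set: R[i]] complex_measurable.
Proof. exact/sigma_algebra_preimage/sigma_algebra_measurable. Qed.

Let complex_measurable0 : complex_measurable set0.
Proof. by case: sigma_algebra_complex. Qed.

Let complex_measurableC A : complex_measurable A -> complex_measurable (~` A).
Proof.
by case: sigma_algebra_complex => _ + _ mA => /(_ _ mA); rewrite setTD.
Qed.

Let complex_measurable_bigcup (F : (set R[i])^nat) :
  (forall i, complex_measurable (F i)) -> complex_measurable (\bigcup_i (F i)).
Proof. by case: sigma_algebra_complex => _ _; apply. Qed.

HB.instance Definition _ := @isMeasurable.Build default_measure_display R[i]
  complex_measurable complex_measurable0 complex_measurableC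
  complex_measurable_bigcup.

Lemma measurable_complex_pair : measurable_fun [set: R[i]] complex_pair.
Proof. by move=> _ Y mY; exists Y. Qed.

Lemma complex_pairK : cancel complex_pair pair_complex.
Proof. by case. Qed.

Lemma pair_complexK : cancel pair_complex complex_pair.
Proof. by case. Qed.

Lemma measurable_pair_complex : measurable_fun [set: mR * mR] pair_complex.
Proof.
move=> _ _ [Y mY <-]; rewrite !setTI -comp_preimage.
suff -> : complex_pair \o pair_complex = id by rewrite preimage_id.
by apply/funext => p /=; rewrite pair_complexK.
Qed.

End complex_measurable.

Section sigma_finite.
Local Open Scope ereal_scope.
Context d1 d2 (T1 : measurableType d1) (T2 : measurableType d2) (R : realType).

Lemma pushforward_sigma_finite (mu : set T1 -> \bar R)
    (f : T1 -> T2) (g : T2 -> T1) : measurable_fun [set: T2] g ->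
  cancel f g -> sigma_finite [set: T1] mu ->
  sigma_finite [set: T2] (pushforward mu f).
Proof.
move=> mg fK [F TF Foo].
exists (fun n => g @^-1` F n); first by rewrite -preimage_bigcup -TF.
move=> n; have [mF muF] := Foo n; split.
  by rewrite -[X in measurable X]setTI; exact: mg.
rewrite /pushforward -comp_preimage.
suff -> : g \o f = id by rewrite preimage_id.
by apply/funext => x /=; rewrite fK.
Qed.

Lemma product_sigma_finite (m1 : {sigma_finite_measure set T1 -> \bar R})
    (m2 : {sigma_finite_measure set T2 -> \bar R}) :
  sigma_finite [set: T1 * T2] (m1 \x m2).
Proof.
have /sigma_finiteP[F [TF ndF Foo]] := sigma_finiteT m1.
have /sigma_finiteP[G [TG ndG Goo]] := sigma_finiteT m2.
exists (fun n => F n `*` G n).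
  rewrite -setXTT TF TG predeqE => -[x y]; split.
    move=> [/= [n _ Fnx] [k _ Gky]]; exists (maxn n k) => //; split.
    - by move: x Fnx; exact/subsetPset/ndF/leq_maxl.
    - by move: y Gky; exact/subsetPset/ndG/leq_maxr.
  by move=> [n _ []/= ? ?]; split; exists n.
move=> k; have [? ?] := Foo k; have [? ?] := Goo k.
split; first exact: measurableX.
by rewrite product_measure1E// lte_mul_pinfty// ge0_fin_numE.
Qed.

End sigma_finite.

Section lebesgue_complex.
Local Open Scope ereal_scope.
Variable R : realType.

Definition lebesgue_complex : set R[i] -> \bar R :=
  pushforward (@lebesgue_measure R \x @lebesgue_measure R) (@pair_complex R).

Let mpc := @measurable_pair_complex R.

Let lebesgue_complex0 : lebesgue_complex set0 = 0.
Proof. exact: measure0. Qed.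

Let lebesgue_complex_ge0 A : 0 <= lebesgue_complex A.
Proof. exact: measure_ge0. Qed.

Let lebesgue_complex_sigma_additive : semi_sigma_additive lebesgue_complex.
Proof. exact: measure_semi_sigma_additive. Qed.

HB.instance Definition _ := isMeasure.Build _ _ _ lebesgue_complex
  lebesgue_complex0 lebesgue_complex_ge0 lebesgue_complex_sigma_additive.

Let lebesgue_complex_sigma_finite : sigma_finite [set: R[i]] lebesgue_complex.
Proof.
apply: (pushforward_sigma_finite (@measurable_complex_pair R)
  (@pair_complexK R)).
exact: product_sigma_finite.
Qed.

HB.instance Definition _ := Measure_isSigmaFinite.Build _ _ _ lebesgue_complex
  lebesgue_complex_sigma_finite.

End lebesgue_complex.

Section tuple_measure.
Local Open Scope ereal_scope.
Context d (T : measurableType d) (R : realType).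

Definition pair_cons n (p : T * n.-tuple T) : n.+1.-tuple T :=
  [the n.+1.-tuple T of p.1 :: p.2].

Definition tuple_pair n (t : n.+1.-tuple T) : T * n.-tuple T :=
  (thead t, [tuple of behead t]).

Lemma measurable_pair_cons n :
  measurable_fun [set: T * n.-tuple T] (@pair_cons n).
Proof. exact: measurable_cons. Qed.

Lemma measurable_tuple_pair n :
  measurable_fun [set: n.+1.-tuple T] (@tuple_pair n).
Proof.
apply: measurable_fun_pair; first exact: measurable_tnth.
exact: measurable_behead.
Qed.

Lemma pair_consK n : cancel (@pair_cons n) (@tuple_pair n).
Proof. by case=> x t; congr pair; apply/val_inj. Qed.

Section cons_measure.
Variables (n : nat) (mu : {sigma_finite_measure set T -> \bar R}).
Variable nu : {sigma_finite_measure set (n.-tuple T) -> \bar R}.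

Definition cons_measure : set (n.+1.-tuple T) -> \bar R :=
  pushforward (mu \x nu) (@pair_cons n).

Let mpc := @measurable_pair_cons n.

Let cons_measure0 : cons_measure set0 = 0.
Proof. exact: measure0. Qed.

Let cons_measure_ge0 A : 0 <= cons_measure A.
Proof. exact: measure_ge0. Qed.

Let cons_measure_sigma_additive : semi_sigma_additive cons_measure.
Proof. exact: measure_semi_sigma_additive. Qed.

HB.instance Definition _ := isMeasure.Build _ _ _ cons_measure
  cons_measure0 cons_measure_ge0 cons_measure_sigma_additive.

Let cons_measure_sigma_finite : sigma_finite [set: n.+1.-tuple T] cons_measure.
Proof.
apply: (pushforward_sigma_finite (@measurable_tuple_pair n) (@pair_consK n)).
exact: product_sigma_finite.
Qed.

HB.instance Definition _ := Measure_isSigmaFinite.Build _ _ _ cons_measure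
  cons_measure_sigma_finite.

End cons_measure.

Variable mu : {sigma_finite_measure set T -> \bar R}.

(* The n-fold product of mu, characterized by tuple_measureE *)
Fixpoint tuple_measure n : {sigma_finite_measure set (n.-tuple T) -> \bar R} :=
  match n with
  | 0%N => \d_[tuple]
  | k.+1 => cons_measure mu (tuple_measure k)
  end.

Lemma tuple_measureE n (A : 'I_n -> set T) : (forall i, measurable (A i)) ->
  tuple_measure n [set t | forall i, A i (tnth t i)] = \prod_(i < n) mu (A i).
Proof.
elim: n A => [|n IHn] A mA.
  by rewrite big_ord0 /= diracE mem_set// => -[].
rewrite big_ord_recl -IHn// -product_measure1E//; last first.
  rewrite (_ : mkset _ = \big[setI/setT]_(i < n)
      ((fun t : n.-tuple T => tnth t i) @^-1` A (lift ord0 i))).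
    apply: bigsetI_measurable => i _; rewrite -[X in measurable X]setTI.
    exact: measurable_tnth.
  apply/seteqP; split => t /=.
    by move=> At; rewrite -bigcap_seq => i _; exact: At.
  rewrite -bigcap_seq /= => At i; apply: (At i).
  by rewrite /= mem_index_enum.
rewrite /= /cons_measure /pushforward; congr (_ _); apply/seteqP; split.
  move=> [x t] /= At; split; first by have := At ord0.
  by move=> i; have := At (lift ord0 i); rewrite tnthS.
move=> [x t] /= [Ax At] i; case: (unliftP ord0 i) => [j|] ->.
  by rewrite tnthS; exact: At.
exact: Ax.
Qed.

End tuple_measure.

Section nls_chain.
Variable R : realType.

(* ord_pred is the predecessor in the cyclic order of 'I_n, and normc is the
   complex modulus with values in R (`|z| is in R[i]) *)
Definition hamiltonian n (psi : n.-tuple R[i]) : R :=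
  n%:R^-1 * (\sum_(x < n) n%:R ^+ 2 / 2 *
     normc (tnth psi x - tnth psi (ord_pred x)) ^+ 2)
  - (4 * n%:R)^-1 * \sum_(x < n) normc (tnth psi x) ^+ 4.

Definition mass n (psi : n.-tuple R[i]) : R :=
  n%:R^-1 * \sum_(x < n) normc (tnth psi x) ^+ 2.

Lemma mass_ge0 n (psi : n.-tuple R[i]) : 0 <= mass psi.
Proof.
rewrite mulr_ge0 ?invr_ge0 ?ler0n//.
by apply: sumr_ge0 => x _; exact: sqr_ge0.
Qed.

Definition mass_sphere n (m : R) : set (n.-tuple R[i]) :=
  [set psi | mass psi = m].

Definition mass_ball n (m : R) : set (n.-tuple R[i]) :=
  [set psi | mass psi <= m].

Arguments mass_sphere n m : clear implicits.
Arguments mass_ball n m : clear implicits.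

Definition ground_energy n (m : R) : R :=
  inf [set hamiltonian psi | psi in mass_sphere n m].

Lemma measurable_normc : measurable_fun [set: R[i]] (@normc R).
Proof.
rewrite (_ : @normc R = (fun p : measurableTypeR R * measurableTypeR R =>
      Num.sqrt ((p.1 : R) ^+ 2 + (p.2 : R) ^+ 2)) \o
    @complex_pair R); last by apply/funext => -[].
apply: measurableT_comp; last exact: measurable_complex_pair.
apply: measurableT_comp.
  by apply: continuous_measurable_fun; exact: sqrt_continuous.
by apply: measurable_funD; apply: measurable_funX.
Qed.

Lemma measurable_mass n : measurable_fun [set: n.-tuple R[i]] (@mass n).
Proof.
apply: measurable_funM; first exact: measurable_cst.
apply: measurable_sum => x; apply: measurable_funX.
by apply: measurableT_comp; [exact: measurable_normc|exact: measurable_tnth].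
Qed.

Lemma measurable_mass_ball n m : measurable (mass_ball n m).
Proof.
rewrite -[X in measurable X]setTI.
rewrite (_ : mass_ball n m = @mass n @^-1` `]-oo, m]); last first.
  by apply/seteqP; split => psi /=; rewrite in_itv.
by apply: measurable_mass => //; exact: measurable_itv.
Qed.

Definition sphere_proj n (m : R) (psi : n.-tuple R[i]) : n.-tuple R[i] :=
  [tuple (Num.sqrt (m / mass psi))%:C * tnth psi x | x < n].

Lemma sphere_projP n m psi : 0 < m -> mass psi != 0 ->
  mass_sphere n m (sphere_proj m psi).
Proof.
move=> m0 psi0; rewrite /mass_sphere /=.
have psi_gt0 : 0 < mass psi.
  by rewrite lt_neqAle eq_sym psi0 mass_ge0.
rewrite {1}/mass; under eq_bigr => x _.
  rewrite tnth_mktuple normcM exprMn /= expr0n addr0 sqrtr_sqr.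
  rewrite real_normK ?num_real// sqr_sqrtr ?divr_ge0 ?ltW//.
  over.
by rewrite -mulr_sumr mulrCA -/(mass psi) divfK.
Qed.

Let measurable_sphere_proj n m :
  measurable_fun [set: n.-tuple R[i]] (@sphere_proj n m).
Proof.
apply/measurable_fun_tnthP => x.
have mx : measurable_fun [set: n.-tuple R[i]]
    (fun psi => complex_pair (tnth psi x)).
  by apply: measurableT_comp; [exact: measurable_complex_pair|
                               exact: measurable_tnth].
have mc : measurable_fun [set: n.-tuple R[i]]
    (fun psi => Num.sqrt (m / mass psi)).
  apply: measurableT_comp.
    by apply: continuous_measurable_fun; exact: sqrt_continuous.
  apply: measurable_funM; first exact: measurable_cst.
  rewrite (_ : (fun psi => _) = (@powR R ^~ (- 1)) \o @mass n); last first.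
    by apply/funext => psi /=; rewrite powR_inv1 ?mass_ge0.
  by apply: measurableT_comp; [exact: measurable_powR|exact: measurable_mass].
rewrite (_ : _ \o _ = @pair_complex R \o (fun psi =>
  (Num.sqrt (m / mass psi) * (complex_pair (tnth psi x)).1,
   Num.sqrt (m / mass psi) * (complex_pair (tnth psi x)).2))); last first.
  apply/funext => psi /=; rewrite tnth_mktuple.
  by case: (tnth psi x) => a b; rewrite /pair_complex /= -[LHS]/(_ +i* _);
    rewrite !mul0r subr0 addr0.
apply: measurableT_comp; first exact: measurable_pair_complex.
apply: measurable_fun_pair; apply: measurable_funM => //.
  exact: (measurableT_comp measurable_fst).
exact: (measurableT_comp measurable_snd).
Qed.

HB.instance Definition _ n m := isMeasurableFun.Build _ _ _ _
  (@sphere_proj n m) (@measurable_sphere_proj n m).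

(* The Dirac mass is the default value required by mnormalize for balls of
   measure 0 or +oo; it is not used for 0 < m. *)
Definition uniform_ball n (m : R) : probability (n.-tuple R[i]) R :=
  mnormalize (mrestr (tuple_measure (@lebesgue_complex R) n)
    (@measurable_mass_ball n m)) \d_point.

Arguments uniform_ball n m : clear implicits.

(* The normalized surface measure of the sphere, as the cone measure: A gets
   the normalized volume of the psi in the ball such that sphere_proj m psi is
   in A *)
Definition uniform_sphere n (m : R) : probability (n.-tuple R[i]) R :=
  distribution (uniform_ball n m) (@sphere_proj n m).

Arguments uniform_sphere n m : clear implicits.

Local Open Scope ereal_scope.

Definition partition_function n (b m : R) : \bar R :=
  \int[uniform_sphere n m]_(psi in mass_sphere n m)
    (expR (- b * hamiltonian psi))%:E.

Definition gibbs n (b m : R) (A : set (n.-tuple R[i])) : \bar R :=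
  (partition_function n b m)^-1 *
  \int[uniform_sphere n m]_(psi in mass_sphere n m `&` A)
    (expR (- b * hamiltonian psi))%:E.

End nls_chain.

Arguments mass_sphere {R} n m.
Arguments mass_ball {R} n m.
Arguments uniform_ball {R} n m.
Arguments uniform_sphere {R} n m.
Arguments partition_function {R} n b m.
Arguments gibbs {R} n b m A.
Arguments ground_energy {R} n m.

(* Main.v *)
(* Let K be the kinetic part of H. The discrete inequality
   |psi(x)|^2 <= M + 2 (t K + 2 M / t) makes the quartic term subordinate to K,
   so that K <= 2 H + C on the sphere and the ground energies stay bounded.
   Contract the ball M <= m by a factor s = c / (k + 1) towards an almost
   minimizer: a psi whose projection has energy at most E_0 + eps + k + 1 lands
   on a point whose projection has energy at most E_0 + eps / 2. Lebesgue
   measure of C^n scales by s^(2n), so the first energy level has at most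
   ((k + 1) / c)^(2n) times the measure of the second one; the factor n^(-2n)
   which both measures carry has cancelled. Weighting the levels by exp(- b H)
   bounds the Gibbs probability of H > E_0 + eps by
   sum_k exp(- b (eps / 2 + k)) ((k + 1) / c)^(2n), which tends to 0 as soon as
   b / n tends to infinity. *)
Require Import Defs.
From mathcomp Require Import all_boot all_order all_algebra.
From mathcomp Require Import all_classical all_reals all_analysis.
From mathcomp Require Import measurable_realfun.
From mathcomp Require Import complex.
From mathcomp Require Import ring lra.
Import Order.TTheory GRing.Theory Num.Theory.
Import numFieldNormedType.Exports.
Import ComplexField.Normc.

Local Open Scope classical_set_scope.
Local Open Scope ring_scope.

(** * Lebesgue measure of C^n under affine maps of positive real ratio *)

Section scaling.
Set Implicit Arguments.
Unset Strict Implicit.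
Local Open Scope ereal_scope.

Section product.
Context d1 d2 (T1 : measurableType d1) (T2 : measurableType d2) (R : realType).
Variables (m1 : {sigma_finite_measure set T1 -> \bar R}).
Variables (m2 : {sigma_finite_measure set T2 -> \bar R}).
Variables (f1 : T1 -> T1) (f2 : T2 -> T2) (c1 c2 : {nonneg R}).
Hypothesis mf1 : measurable_fun setT f1.
Hypothesis f1E : forall A, measurable A -> m1 (f1 @^-1` A) = c1%:num%:E * m1 A.
Hypothesis f2E : forall A, measurable A -> m2 (f2 @^-1` A) = c2%:num%:E * m2 A.

(** Fubini: the section of the preimage at [x] is the [f2]-preimage of the section of [A] at [f1 x],
    and the pushforward of [m1] by [f1] is [c1] times [m1]. *)
Lemma product_measure_preimage_scale (A : set (T1 * T2)) : measurable A ->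
  (m1 \x m2) ((fun p => (f1 p.1, f2 p.2)) @^-1` A) =
  (c1%:num * c2%:num)%:E * (m1 \x m2) A.
Proof.
move=> mA; have mF := @measurable_fun_xsection _ _ _ _ _ m2 _ mA.
rewrite /product_measure1.
transitivity (\int[m1]_x (c2%:num%:E * ((m2 \o xsection A) \o f1) x)).
  apply: eq_integral => x _ /=; rewrite -f2E; last exact: measurable_xsection.
  by congr (m2 _); apply/seteqP; split => y /=; rewrite /xsection /= !inE.
have mFf1 : measurable_fun setT ((m2 \o xsection A) \o f1).
  exact: measurableT_comp.
rewrite ge0_integralZl//.
rewrite [X in _ * X](_ : _ = c1%:num%:E * \int[m1]_x (m2 \o xsection A) x);
  last first.
  rewrite -ge0_integral_mscale//.
  transitivity (\int[pushforward m1 f1]_x (m2 \o xsection A) x).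
    by rewrite ge0_integral_pushforward// => x _; exact: measure_ge0.
  by apply: eq_measure_integral => B mB _; exact: f1E.
by rewrite muleA -EFinM mulrC.
Qed.

End product.

Context {R : realType}.

Let affineR (s a : R) : measurableTypeR R -> measurableTypeR R :=
  fun x => (a + s * x)%R.

Lemma measurable_affine (s a : R) :
  measurable_fun [set: measurableTypeR R] (affineR s a).
Proof. by apply: measurable_funD => //; exact: measurable_funM. Qed.

(** By uniqueness of Lebesgue measure: [s] times the pushforward gives each half-open interval its
    length. *)
Lemma lebesgue_measure_preimage_affine (s a : R) (s0 : (0 < s)%R)
    (A : set (measurableTypeR R)) : measurable A ->
  lebesgue_measure (affineR s a @^-1` A) =
  (s^-1)%:E * lebesgue_measure A.
Proof.
move=> mA; have s0' : (0 <= s)%R by exact: ltW.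
pose f := affineR s a.
have mf : measurable_fun setT f by exact: measurable_affine.
suff -> : lebesgue_measure A = s%:E * lebesgue_measure (f @^-1` A).
  by rewrite muleA -EFinM mulVf ?mul1e// gt_eqF.
apply: (lebesgue_measure_unique
  (mu := mscale (NngNum s0') (pushforward lebesgue_measure f))) mA => //.
move=> _ [[x y]] _ <-.
transitivity (s%:E * lebesgue_measure (f @^-1` `]x, y]%classic)) => //.
have -> : f @^-1` `]x, y]%classic = `]((x - a) / s)%R, ((y - a) / s)%R]%classic.
  apply/seteqP; split => z /=; rewrite !in_itv /= ltr_pdivrMr// ler_pdivlMr//;
    by rewrite ltrBlDl lerBrDl mulrC.
rewrite !lebesgue_measure_itv /= !lte_fin ltr_pM2r ?invr_gt0// ltrD2r.
case: ifP => _; last by rewrite mule0.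
by rewrite -!EFinB -EFinM; congr EFin; field; rewrite gt_eqF.
Qed.

Let affineE (s x y : R) (a : R[i]) : (a + s%:C%C * (x +i* y)%C)%R =
  ((complex.Re a + s * x)%R +i* (complex.Im a + s * y)%R)%C.
Proof.
by case: a => b c; apply/eqP; rewrite eq_complex /= !mul0r subr0 addr0 !eqxx.
Qed.

Lemma lebesgue_complex_preimage_affine (s : R) (a : R[i]) (s0 : (0 < s)%R)
    (A : set R[i]) : measurable A ->
  lebesgue_complex ((fun z => (a + s%:C%C * z)%R) @^-1` A) =
  ((s^-1 * s^-1)%R)%:E * lebesgue_complex A.
Proof.
move=> mA; have sV0 : (0 <= s^-1)%R by rewrite invr_ge0 ltW.
have mA' : measurable (@pair_complex R @^-1` A).
  by rewrite -[X in measurable X]setTI; exact: measurable_pair_complex.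
pose f := affineR s.
have := @product_measure_preimage_scale _ _ _ _ R (@lebesgue_measure R)
  (@lebesgue_measure R) (f (complex.Re a)) (f (complex.Im a))
  (NngNum sV0) (NngNum sV0) (measurable_affine _ _)
  (fun B mB => lebesgue_measure_preimage_affine (complex.Re a) s0 mB)
  (fun B mB => lebesgue_measure_preimage_affine (complex.Im a) s0 mB) _ mA'.
rewrite /lebesgue_complex /pushforward => <-; congr (_ _).
apply/seteqP; split => -[x y] /=; rewrite /pair_complex /f /=;
  by rewrite affineE.
Qed.

Lemma measurable_complex_affine (s : R) (a : R[i]) :
  measurable_fun [set: R[i]] (fun z => (a + s%:C%C * z)%R).
Proof.
have -> : (fun z => (a + s%:C%C * z)%R) = @pair_complex R \o (fun p =>
    (affineR s (complex.Re a) p.1, affineR s (complex.Im a) p.2)) \o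
    @complex_pair R.
  by apply/funext => -[x y] /=; rewrite affineE.
apply: measurableT_comp; last exact: measurable_complex_pair.
apply: measurableT_comp; first exact: measurable_pair_complex.
apply: measurable_fun_pair.
  exact: (measurableT_comp (measurable_affine _ _) measurable_fst).
exact: (measurableT_comp (measurable_affine _ _) measurable_snd).
Qed.

Definition tuple_affine n (s : R) (a psi : n.-tuple R[i]) : n.-tuple R[i] :=
  [tuple (tnth a x + s%:C%C * tnth psi x)%R | x < n].

Lemma measurable_tuple_affine n (s : R) (a : n.-tuple R[i]) :
  measurable_fun [set: n.-tuple R[i]] (tuple_affine s a).
Proof.
apply/measurable_fun_tnthP => x.
rewrite (_ : _ \o _ = (fun z => (tnth a x + s%:C%C * z)%R) \o
    (fun t : n.-tuple R[i] => tnth t x)).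
  apply: measurableT_comp; first exact: measurable_complex_affine.
  exact: measurable_tnth.
by apply/funext => psi /=; rewrite tnth_mktuple.
Qed.

(** Induction on [n], splitting off the head; a complex coordinate has two real dimensions and
    contributes [s^-1 * s^-1]. *)
Lemma lebesgue_preimage_affine n (s : R) (a : n.-tuple R[i]) (s0 : (0 < s)%R)
    (A : set (n.-tuple R[i])) : measurable A ->
  tuple_measure (@lebesgue_complex R) n (tuple_affine s a @^-1` A) =
  ((s^-1 * s^-1) ^+ n)%:E * tuple_measure (@lebesgue_complex R) n A.
Proof.
elim: n a A => [|n IHn] a A mA.
  rewrite expr0 mul1e /= /tuple_affine; congr (\d_ _ _).
  by apply/seteqP; split => t /=; rewrite (tuple0 [tuple _ | _ < _]) (tuple0 t).
have sV0 : (0 <= s^-1 * s^-1)%R by rewrite mulr_ge0// invr_ge0 ltW.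
have sVn0 : (0 <= (s^-1 * s^-1) ^+ n)%R by rewrite exprn_ge0.
have mA' : measurable (@pair_cons _ (R[i]) n @^-1` A).
  by rewrite -[X in measurable X]setTI; exact: measurable_pair_cons.
have := @product_measure_preimage_scale _ _ _ _ R (@lebesgue_complex R)
  (tuple_measure (@lebesgue_complex R) n) (fun z => (thead a + s%:C%C * z)%R)
  (tuple_affine s [tuple of behead a])
  (NngNum sV0) (NngNum sVn0) (measurable_complex_affine _ _)
  (fun B mB => lebesgue_complex_preimage_affine (thead a) s0 mB)
  (fun B mB => IHn [tuple of behead a] B mB) _ mA'.
rewrite exprS /= /cons_measure /pushforward => <-; congr (_ _).
apply/seteqP; split => -[x y] /=;
  rewrite (_ : tuple_affine s a (pair_cons (x, y)) =
    pair_cons ((thead a + s%:C%C * x)%R,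
      tuple_affine s [tuple of behead a] y))//;
  apply/eq_from_tnth => i; rewrite tnth_mktuple;
  case: (unliftP ord0 i) => [j|] ->;
  rewrite ?tnthS ?tnth0 ?tnth_mktuple ?tnth_behead //;
  by congr (tnth _ _ + _)%R; apply/val_inj; rewrite /= inordK// ltnS.
Qed.

End scaling.

(** * Kinetic and quartic energy at fixed mass *)

Section energy.
Context {R : realType}.
Set Implicit Arguments.
Unset Strict Implicit.

Definition kinetic n (psi : n.-tuple R[i]) : R :=
  n%:R^-1 * \sum_(x < n) n%:R ^+ 2 / 2 *
    normc (tnth psi x - tnth psi (ord_pred x)) ^+ 2.

Definition quartic n (psi : n.-tuple R[i]) : R :=
  n%:R^-1 * \sum_(x < n) normc (tnth psi x) ^+ 4.

(** The contraction of ratio [s] towards [a], in the [tuple_affine] form to which the volume scaling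
    applies. *)
Definition homothety n (s : R) (a psi : n.-tuple R[i]) : n.-tuple R[i] :=
  tuple_affine s [tuple (1 - s)%:C%C * tnth a x | x < n] psi.

Lemma hamiltonianE n (psi : n.-tuple R[i]) :
  hamiltonian psi = kinetic psi - quartic psi / 4.
Proof. by rewrite /hamiltonian invfM /kinetic /quartic; ring. Qed.

Lemma normc_sqr (z : R[i]) :
  normc z ^+ 2 = complex.Re z ^+ 2 + complex.Im z ^+ 2.
Proof. by case: z => a b; rewrite /= sqr_sqrtr// addr_ge0 ?sqr_ge0. Qed.

Lemma normc_ge0 (z : R[i]) : 0 <= normc z.
Proof. by case: z => a b; exact: sqrtr_ge0. Qed.

Lemma normc_sqrM (c : R) (z : R[i]) :
  normc (c%:C%C * z) ^+ 2 = c ^+ 2 * normc z ^+ 2.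
Proof. by case: z => a b; rewrite !normc_sqr /=; ring. Qed.

Lemma expr4 (x : R) : x ^+ 4 = (x ^+ 2) ^+ 2.
Proof. by rewrite -exprM. Qed.

Lemma normc_sqr_convex (s : R) (z w : R[i]) : 0 <= s <= 1 ->
  normc ((1 - s)%:C%C * z + s%:C%C * w) ^+ 2 <=
  (1 - s) * normc z ^+ 2 + s * normc w ^+ 2.
Proof.
move=> /andP[s0 s1]; case: z w => [a b] [c d]; rewrite !normc_sqr /=.
rewrite -subr_ge0.
rewrite [leRHS](_ : _ = s * (1 - s) * ((a - c) ^+ 2 + (b - d) ^+ 2));
  last by ring.
by rewrite !mulr_ge0 ?subr_ge0 ?addr_ge0 ?sqr_ge0.
Qed.

(** The loss is linear in [s]: the difference of the two sides is s (1 - s) |z + w|^2 + 2 s^2 (|z|^2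
    + |w|^2). *)
Lemma normc_sqr_ge (s : R) (z w : R[i]) : 0 <= s <= 1 ->
  normc z ^+ 2 - s * (3 * normc z ^+ 2 + normc w ^+ 2) <=
  normc ((1 - s)%:C%C * z + s%:C%C * w) ^+ 2.
Proof.
move=> /andP[s0 s1]; case: z w => [a b] [c d]; rewrite !normc_sqr /=.
rewrite -subr_ge0.
rewrite [leRHS](_ : _ = s * (1 - s) * ((a + c) ^+ 2 + (b + d) ^+ 2) +
  2 * s ^+ 2 * (a ^+ 2 + b ^+ 2 + c ^+ 2 + d ^+ 2)); last by ring.
by rewrite addr_ge0 ?mulr_ge0 ?subr_ge0 ?addr_ge0 ?sqr_ge0.
Qed.

Lemma kinetic_ge0 n (psi : n.-tuple R[i]) : 0 <= kinetic psi.
Proof.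
rewrite mulr_ge0 ?invr_ge0// sumr_ge0// => x _.
by rewrite mulr_ge0 ?sqr_ge0// mulr_ge0 ?sqr_ge0 ?invr_ge0.
Qed.

Lemma quartic_ge0 n (psi : n.-tuple R[i]) : 0 <= quartic psi.
Proof.
by rewrite mulr_ge0 ?invr_ge0// sumr_ge0// => x _; rewrite expr4 sqr_ge0.
Qed.

Lemma mass_sum n (psi : n.-tuple R[i]) : (0 < n)%N ->
  \sum_(x < n) normc (tnth psi x) ^+ 2 = n%:R * mass psi.
Proof. by move=> n0; rewrite /mass mulVKf// pnatr_eq0 -lt0n. Qed.

Lemma mass_sum_pred n (psi : n.-tuple R[i]) : (0 < n)%N ->
  \sum_(x < n) normc (tnth psi (ord_pred x)) ^+ 2 = n%:R * mass psi.
Proof.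
move=> n0; rewrite -mass_sum//.
by rewrite [RHS](reindex_inj (can_inj (@ord_predK n))).
Qed.

Lemma kinetic_le n (psi : n.-tuple R[i]) : (0 < n)%N ->
  kinetic psi <= 2 * n%:R ^+ 2 * mass psi.
Proof.
move=> n0; have n0' : 0 < n%:R :> R by rewrite ltr0n.
rewrite /kinetic ler_pdivrMl//.
rewrite [leRHS](_ : _ = n%:R ^+ 2 * (n%:R * mass psi + n%:R * mass psi));
  last by ring.
rewrite -{1}mass_sum// -mass_sum_pred// -big_split mulr_sumr /=.
apply: ler_sum => x _; rewrite -mulrA ler_wpM2l ?sqr_ge0//.
case: (tnth psi x) => a b; case: (tnth psi _) => c d; rewrite !normc_sqr /=.
have := sqr_ge0 (a + c); have := sqr_ge0 (b + d); lra.
Qed.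

(** Both values are compared with the one at site 0, along paths that avoid the bond closing the
    cycle; the two paths give the factor 2. *)
Lemma sum_pred_diff_ge n (f : 'I_n -> R) (x y : 'I_n) :
  f x - f y <= 2 * \sum_(z < n) `|f z - f (ord_pred z)|.
Proof.
case: n f x y => [f []//|n] f x y.
pose g i := f (inord i).
have h (z : 'I_n.+1) :
    `|f z - f ord0| <= \sum_(z < n.+1) `|f z - f (ord_pred z)|.
  have -> : f z = g z by rewrite /g inord_val.
  have -> : f ord0 = g 0%N.
    by rewrite /g; congr f; apply/val_inj; rewrite /= inordK.
  rewrite -(telescope_sumr _ (leq0n z)).
  apply: (le_trans (ler_norm_sum _ _ _)).
  (* The summand split off belongs to the closing bond, which the path does not cross. *)
  rewrite big_ord_recl -[leLHS]add0r lerD//.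
  apply: (@le_trans _ _ (\sum_(0 <= i < n) `|g i.+1 - g i|)).
    rewrite [leRHS](big_cat_nat (n := z)) //=; last by rewrite -ltnS.
    by rewrite lerDl sumr_ge0.
  rewrite big_mkord; apply: ler_sum => i _.
  rewrite le_eqVlt; apply/orP; left; apply/eqP; congr `|f _ - f _|.
    by apply/val_inj; rewrite /= inordK// ltnS.
  apply/val_inj; rewrite /= inordK//; last by rewrite ltnS ltnW.
  by rewrite add0n modnDr modn_small// ltnS ltnW.
have := h x; have := h y; rewrite !ler_norml => /andP[? ?] /andP[? ?].
lra.
Qed.

(* Discrete Agmon inequality: a point value is compared with the mean through
   the total variation of |psi|^2. *)
Lemma normc_sqr_le n (psi : n.-tuple R[i]) (t : R) (x : 'I_n) : 0 < t ->
  normc (tnth psi x) ^+ 2 <=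
  mass psi + 2 * (t * kinetic psi + 2 * mass psi / t).
Proof.
move=> t0; have n0 : (0 < n)%N by case: n {psi} x => // -[].
have n0' : 0 < n%:R :> R by rewrite ltr0n.
pose f z := normc (tnth psi z) ^+ 2.
pose S := \sum_(z < n) `|f z - f (ord_pred z)|.
(* Weighted inequality d (p + q) <= u d^2 / 2 + (p^2 + q^2) / u with u = n t, where d is the modulus
   of the increment and p, q are the moduli at its two ends. *)
have SK : S <= t * kinetic psi + 2 * mass psi / t.
  rewrite [leRHS](_ : _ = \sum_(z < n) (n%:R * t / 2 *
      normc (tnth psi z - tnth psi (ord_pred z)) ^+ 2 +
      (n%:R * t)^-1 * (f z + f (ord_pred z)))); last first.
    rewrite big_split /= -!mulr_sumr big_split /= mass_sum// mass_sum_pred//.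
    by rewrite /kinetic -mulr_sumr; field; rewrite !gt_eqF.
  apply: ler_sum => z _; rewrite /f.
  set a := tnth psi z; set b := tnth psi _.
  have ab : normc a <= normc (a - b) + normc b.
    by rewrite -{1}(subrK b a); exact: le_normcD.
  have ba : normc b <= normc (a - b) + normc a.
    rewrite -{1}(subrK a b); apply: (le_trans (le_normcD _ _)).
    by rewrite -(opprB a b) normcN.
  have := normc_ge0 (a - b); have := normc_ge0 a; have := normc_ge0 b.
  move: (normc a) (normc b) (normc (a - b)) ab ba => p q d pq qp q0 p0 d0.
  have tau0 : 0 < n%:R * t by rewrite mulr_gt0.
  have pqd : `|p ^+ 2 - q ^+ 2| <= d * (p + q).
    rewrite subr_sqr normrM (ger0_norm (addr_ge0 p0 q0)).
    rewrite ler_wpM2r ?addr_ge0// ler_norml; apply/andP; split; lra.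
  apply: (le_trans pqd); move: (n%:R * t) tau0 => u u0.
  rewrite -subr_ge0.
  rewrite [leRHS](_ : _ = (2 * u)^-1 * ((u * d - (p + q)) ^+ 2 + (p - q) ^+ 2));
    last by field; rewrite gt_eqF.
  by rewrite mulr_ge0 ?addr_ge0 ?sqr_ge0// invr_ge0 mulr_ge0// ltW.
(* Averaging over [y] turns the comparison value |psi(y)|^2 into the mass. *)
have : \sum_(y < n) f x <= \sum_(y < n) (f y + 2 * S).
  by apply: ler_sum => y _; have := sum_pred_diff_ge f x y; rewrite -/S; lra.
rewrite big_split /= mass_sum// !sumr_const card_ord -[leLHS]mulr_natl.
rewrite -[X in _ + X]mulr_natl -mulrDr ler_pM2l// => /le_trans; apply.
by rewrite lerD2l ler_pM2l.
Qed.

Lemma quartic_le n (psi : n.-tuple R[i]) (B : R) :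
  (forall x, normc (tnth psi x) ^+ 2 <= B) -> quartic psi <= B * mass psi.
Proof.
move=> hB; rewrite /quartic /mass mulrCA ler_wpM2l ?invr_ge0// mulr_sumr.
by apply: ler_sum => x _; rewrite expr4 expr2 ler_wpM2r ?sqr_ge0.
Qed.

(** The pointwise bound with t = 1 / m gives a quartic term of at most 2 K + m^2 + 4 m^3, and a
    quarter of it uses up only half of K. *)
Lemma kinetic_le_hamiltonian n (psi : n.-tuple R[i]) (m : R) : 0 < m ->
  mass psi = m ->
  kinetic psi <= 2 * hamiltonian psi + (m ^+ 2 / 2 + 2 * m ^+ 3).
Proof.
move=> m0 psim; have Q : quartic psi <=
    (m + 2 * (m^-1 * kinetic psi + 2 * m / m^-1)) * m.
  rewrite -[X in _ * X]psim; apply: quartic_le => x.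
  by have := @normc_sqr_le n psi m^-1 x; rewrite psim invr_gt0; exact.
have E : (m + 2 * (m^-1 * kinetic psi + 2 * m / m^-1)) * m =
    m ^+ 2 + 2 * kinetic psi + 4 * m ^+ 3 by field; rewrite gt_eqF.
by rewrite E in Q; rewrite hamiltonianE; lra.
Qed.

(** * Energy and mass along a contraction *)

Section homothety.
Variables (n : nat) (s : R) (a psi : n.-tuple R[i]).
Hypothesis s01 : 0 <= s <= 1.

Let n1 : 0 <= n%:R^-1 :> R. Proof. by rewrite invr_ge0. Qed.

Lemma kinetic_homothety :
  kinetic (homothety s a psi) <= (1 - s) * kinetic a + s * kinetic psi.
Proof.
rewrite /kinetic !(mulrCA _ n%:R^-1) -mulrDr ler_wpM2l// !mulr_sumr.
rewrite -big_split /=.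
apply: ler_sum => x _.
rewrite !tnth_mktuple !(mulrCA _ (n%:R ^+ 2 / 2)) -mulrDr.
rewrite ler_wpM2l ?mulr_ge0// ?sqr_ge0// ?invr_ge0//.
apply: le_trans (normc_sqr_convex _ _ s01).
by rewrite !mulrBr opprD addrACA.
Qed.

Lemma mass_homothety_le :
  mass (homothety s a psi) <= (1 - s) * mass a + s * mass psi.
Proof.
rewrite /mass !(mulrCA _ n%:R^-1) -mulrDr ler_wpM2l// !mulr_sumr -big_split /=.
by apply: ler_sum => x _; rewrite !tnth_mktuple; exact: normc_sqr_convex.
Qed.

Lemma mass_homothety_ge :
  mass a - s * (3 * mass a + mass psi) <= mass (homothety s a psi).
Proof.
rewrite /mass !(mulrCA _ n%:R^-1) -mulrDr !(mulrCA _ n%:R^-1) -mulrBr.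
rewrite ler_wpM2l// !mulr_sumr -big_split /= mulr_sumr -sumrB /=.
by apply: ler_sum => x _; rewrite !tnth_mktuple; exact: normc_sqr_ge.
Qed.

(** The square is bounded below by its tangent at |a(x)|^2, so the linear loss of [normc_sqr_ge]
    gets multiplied by 2 |a(x)|^2 <= 2 B; [psi] enters through its mass alone. *)
Lemma quartic_homothety (B : R) : (forall x, normc (tnth a x) ^+ 2 <= B) ->
  quartic a - 2 * s * B * (3 * mass a + mass psi) <=
  quartic (homothety s a psi).
Proof.
move=> hB; have [s0 _] := andP s01.
rewrite /quartic /mass !(mulrCA _ n%:R^-1) -mulrDr !(mulrCA _ n%:R^-1) -mulrBr.
rewrite ler_wpM2l// !mulr_sumr -big_split /= mulr_sumr -sumrB /=.
apply: ler_sum => x _; rewrite !tnth_mktuple.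
have := normc_sqr_ge (tnth a x) (tnth psi x) s01.
rewrite !expr4; have := hB x.
have := sqr_ge0 (normc (tnth a x)); have := sqr_ge0 (normc (tnth psi x)).
move: (normc (tnth a x) ^+ 2) (normc (tnth psi x) ^+ 2)
  (normc (_ + _) ^+ 2).
move=> p q c q0 p0 pB pc.
have c2 : 2 * p * c - p ^+ 2 <= c ^+ 2 by have := sqr_ge0 (c - p); lra.
apply: le_trans c2; have r0 : 0 <= s * (3 * p + q).
  by rewrite mulr_ge0// addr_ge0// mulr_ge0.
have : p * (s * (3 * p + q)) <= B * (s * (3 * p + q)) by rewrite ler_wpM2r.
have : p * (p - s * (3 * p + q)) <= p * c by rewrite ler_wpM2l.
lra.
Qed.

End homothety.

(** * Homogeneity of the energies under projection to the sphere *)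

Section sphere_proj.
Variables (n : nat) (m : R) (psi : n.-tuple R[i]).
Hypothesis m0 : 0 < m.

Let sqr_ratio : Num.sqrt (m / mass psi) ^+ 2 = m / mass psi.
Proof. by rewrite sqr_sqrtr// divr_ge0 ?mass_ge0// ltW. Qed.

Lemma kinetic_sphere_proj :
  kinetic (sphere_proj m psi) = m / mass psi * kinetic psi.
Proof.
rewrite /kinetic mulrCA; congr (_ * _); rewrite mulr_sumr.
apply: eq_bigr => x _.
by rewrite !tnth_mktuple -mulrBr normc_sqrM sqr_ratio mulrCA.
Qed.

Lemma quartic_sphere_proj :
  quartic (sphere_proj m psi) = (m / mass psi) ^+ 2 * quartic psi.
Proof.
rewrite /quartic mulrCA; congr (_ * _); rewrite mulr_sumr.
apply: eq_bigr => x _.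
by rewrite !tnth_mktuple !expr4 normc_sqrM sqr_ratio exprMn.
Qed.

Lemma kinetic_le_sphere_proj : mass psi != 0 -> mass psi <= m ->
  kinetic psi <= kinetic (sphere_proj m psi).
Proof.
move=> psi0 psim; rewrite kinetic_sphere_proj ler_peMl ?kinetic_ge0//.
by rewrite ler_pdivlMr ?mul1r// lt_neqAle eq_sym psi0 mass_ge0.
Qed.

End sphere_proj.

(** The contraction lowers the mass by at most 4 s m, so projecting multiplies K by at most 1 + 8 s,
    on top of its convexity bound. The quartic term loses at most 8 s B m in the contraction, and
    projecting only increases it. *)
Lemma hamiltonian_homothety n (m s B : R) (a psi : n.-tuple R[i]) : 0 < m ->
  0 <= s <= 8^-1 -> mass a = m -> mass psi <= m ->
  (forall x, normc (tnth a x) ^+ 2 <= B) ->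
  [/\ mass (homothety s a psi) <= m, mass (homothety s a psi) != 0 &
   hamiltonian (sphere_proj m (homothety s a psi)) <=
   hamiltonian a + s * (8 * kinetic a + 2 * kinetic psi + 2 * B * m)].
Proof.
move=> m0 /andP[s0 s8] am psim hB.
have s01 : 0 <= s <= 1 by rewrite s0; lra.
have n0 : (0 < n)%N.
  case: n a psi am {psim hB} => // a psi; rewrite /mass big_ord0 mulr0 => m0'.
  by rewrite -m0' ltxx in m0.
have B0 : 0 <= B by apply: le_trans (hB (Ordinal n0)); exact: sqr_ge0.
have := mass_homothety_ge a psi s01; have := mass_homothety_le a psi s01.
have := kinetic_homothety a psi s01; have := quartic_homothety psi s01 hB.
set chi := homothety s a psi; rewrite am => hQ hK hM1 hM2.
have spsi : s * mass psi <= s * m by rewrite ler_wpM2l.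
have sm : s * m <= 8^-1 * m by rewrite ler_wpM2r// ltW.
have sBpsi : s * B * mass psi <= s * B * m by rewrite ler_wpM2l// mulr_ge0.
have chim : mass chi <= m by lra.
have chi_ge : m * (1 - 4 * s) <= mass chi by lra.
have chi0 : 0 < mass chi by apply: lt_le_trans chi_ge; rewrite mulr_gt0//; lra.
split=> //; first by rewrite gt_eqF.
have l1 : 1 <= m / mass chi by rewrite ler_pdivlMr// mul1r.
(* (1 + 8 s) (1 - 4 s) = 1 + 4 s (1 - 8 s) is at least 1 because s <= 1/8. *)
have l2 : m / mass chi <= 1 + 8 * s.
  rewrite ler_pdivrMr//.
  apply: (@le_trans _ _ ((1 + 8 * s) * (m * (1 - 4 * s)))).
    have : 0 <= m * s * (1 - 8 * s) by rewrite !mulr_ge0 ?(ltW m0)//; lra.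
    lra.
  by rewrite ler_wpM2l//; lra.
rewrite !hamiltonianE kinetic_sphere_proj// quartic_sphere_proj//.
move: (m / _) l1 l2 => l l1 l2.
have K0 := kinetic_ge0 chi; have Q0 := quartic_ge0 chi.
have Ka := kinetic_ge0 a; have Kp := kinetic_ge0 psi.
have h1 : l * kinetic chi <= (1 + 8 * s) * kinetic chi by rewrite ler_wpM2r.
have h2 : quartic chi <= l ^+ 2 * quartic chi by rewrite ler_peMl// exprn_ege1.
have h3 : (1 + 8 * s) * kinetic chi <=
    (1 + 8 * s) * (kinetic a + s * kinetic psi).
  rewrite ler_wpM2l//; first by lra.
  by apply: (le_trans hK); rewrite lerD2r mulrBl mul1r gerBl mulr_ge0.
have h4 : s * (8 * s) * kinetic psi <= s * 1 * kinetic psi.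
  by rewrite ler_wpM2r// ler_wpM2l//; lra.
lra.
Qed.

(** * Bounds on the ground energy *)

Lemma mass_sphere_nonempty n (m : R) : (0 < n)%N -> 0 < m ->
  exists2 psi : n.-tuple R[i], mass psi = m & hamiltonian psi <= 0.
Proof.
move=> n0 m0; have n0' : n%:R != 0 :> R by rewrite pnatr_eq0 -lt0n.
(* A constant has no kinetic energy; this bounds the ground energies by 0 whatever [n] is. *)
exists [tuple (Num.sqrt m)%:C%C | x < n].
  rewrite /mass; under eq_bigr => x _.
    rewrite tnth_mktuple normc_sqr /= expr0n addr0 sqr_sqrtr ?ltW//.
    over.
  by rewrite sumr_const card_ord -[m *+ n]mulr_natl mulKf.
rewrite hamiltonianE; have := quartic_ge0 [tuple (Num.sqrt m)%:C%C | x < n].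
suff -> : kinetic [tuple (Num.sqrt m)%:C%C | x < n] = 0 by lra.
rewrite /kinetic big1 ?mulr0// => x _.
by rewrite !tnth_mktuple subrr normc0 expr0n mulr0.
Qed.

Lemma has_inf_energy n (m : R) : (0 < n)%N -> 0 < m ->
  has_inf [set hamiltonian psi | psi in @mass_sphere R n m].
Proof.
move=> n0 m0; split.
  have [psi psim _] := mass_sphere_nonempty n0 m0.
  by exists (hamiltonian psi), psi.
exists (- (m ^+ 2 / 4 + m ^+ 3)) => _ [psi psim <-].
by have := kinetic_le_hamiltonian m0 psim; have := kinetic_ge0 psi; lra.
Qed.

Lemma ground_energy_le0 n (m : R) : (0 < n)%N -> 0 < m ->
  ground_energy n m <= 0 :> R.
Proof.
move=> n0 m0; have [psi psim psi0] := mass_sphere_nonempty n0 m0.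
by apply: le_trans psi0; apply: (ge_inf (has_inf_energy n0 m0).2); exists psi.
Qed.

Lemma ground_energy_le n (m : R) (psi : n.-tuple R[i]) : (0 < n)%N -> 0 < m ->
  mass psi = m -> ground_energy n m <= hamiltonian psi.
Proof.
by move=> n0 m0 psim; apply: (ge_inf (has_inf_energy n0 m0).2); exists psi.
Qed.

Lemma ground_energy_adherent n (m eps : R) : (0 < n)%N -> 0 < m -> 0 < eps ->
  exists2 psi : n.-tuple R[i], mass psi = m &
    hamiltonian psi <= ground_energy n m + eps.
Proof.
move=> n0 m0 e0.
have [_ [psi psim <-] /ltW] := inf_adherent e0 (has_inf_energy n0 m0).
by exists psi.
Qed.

End energy.

(** * Volume of mass balls and the uniform measure of the sphere *)

Section volume.
Set Implicit Arguments.
Unset Strict Implicit.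
Local Open Scope ereal_scope.
Context {R : realType}.

Local Notation vol n := (tuple_measure (@lebesgue_complex R) n).

Lemma lebesgue_complex_rect (I J : set (measurableTypeR R)) :
  measurable I -> measurable J ->
  lebesgue_complex (@complex_pair R @^-1` (I `*` J)) =
  lebesgue_measure I * lebesgue_measure J.
Proof.
move=> mI mJ; rewrite /lebesgue_complex /pushforward -comp_preimage.
rewrite (_ : _ \o _ = id); first by rewrite preimage_id product_measure1E.
by apply/funext => p /=; rewrite pair_complexK.
Qed.

Let square (x y : R) : set R[i] :=
  @complex_pair R @^-1` (`[x, y]%classic `*` `[x, y]%classic).

Let measurable_square x y : measurable (square x y).
Proof.
rewrite -[X in measurable X]setTI.
by apply: measurable_complex_pair => //; exact: measurableX.
Qed.

Lemma tuple_measure_cube n (x y : R) : (x <= y)%R ->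
  vol n [set t | forall i, square x y (tnth t i)] =
  ((y - x) ^+ 2 ^+ n)%:E.
Proof.
move=> xy; rewrite (@tuple_measureE _ _ _ (@lebesgue_complex R) n
  (fun=> square x y)) => [|_]; last exact: measurable_square.
rewrite (eq_bigr (fun=> ((y - x) ^+ 2)%:E)).
  elim: n => [|n IHn]; first by rewrite big_ord0.
  by rewrite big_ord_recl IHn (exprS _ n) EFinM.
move=> i _.
rewrite [LHS](lebesgue_complex_rect (measurable_itv _) (measurable_itv _)).
rewrite lebesgue_measure_itv /= lte_fin expr2 EFinM.
by case: ltgtP xy => // -> _; rewrite subrr.
Qed.

Lemma measurable_tuple_pred n (A : set R[i]) : measurable A ->
  measurable [set t : n.-tuple R[i] | forall i, A (tnth t i)].
Proof.
move=> mA; rewrite (_ : mkset _ =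
  \bigcap_(i in [set: 'I_n]) ((@tnth n _)^~ i @^-1` A)); last first.
  by apply/seteqP; split => t /= h i => [_|]; exact: h.
apply: fin_bigcap_measurable => // i _.
by rewrite -[X in measurable X]setTI; exact: measurable_tnth.
Qed.

Lemma mass_ball_lty n (m : R) : vol n (mass_ball n m) < +oo.
Proof.
(* Since [r] is at least 1, |psi(i)|^2 <= n |m| <= r <= r^2, which puts the ball inside the cube of
   half-side [r]. *)
pose r := (n%:R * `|m| + 1)%R.
have r0 : (1 <= r)%R by rewrite lerDr mulr_ge0.
have rr : (- r <= r)%R by lra.
apply: (@le_lt_trans _ _ ((r - - r) ^+ 2 ^+ n)%:E); last exact: ltry.
rewrite -tuple_measure_cube//; apply: le_measure; rewrite ?inE.
- exact: measurable_mass_ball.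
- exact: measurable_tuple_pred.
- move=> psi /= psim i.
  have n0 : (0 < n)%N by exact: leq_ltn_trans (ltn_ord i).
  have : (normc (tnth psi i) ^+ 2 <= r ^+ 2)%R.
    apply: (@le_trans _ _ (\sum_(x < n) normc (tnth psi x) ^+ 2)%R).
      by rewrite (bigD1 i)//= lerDl sumr_ge0// => j _; exact: sqr_ge0.
    rewrite mass_sum//; apply: (@le_trans _ _ r).
      apply: (@le_trans _ _ (n%:R * `|m|)%R); last by rewrite lerDl.
      by rewrite ler_wpM2l//; apply: (le_trans psim); exact: ler_norm.
    by rewrite ler_eXnr.
  rewrite normc_sqr /square /complex_pair /=; case: (tnth psi i) => a b /= h.
  have ha : (a ^+ 2 <= r ^+ 2)%R by apply: le_trans h; rewrite lerDl sqr_ge0.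
  have hb : (b ^+ 2 <= r ^+ 2)%R by apply: le_trans h; rewrite lerDr sqr_ge0.
  have norm_le (x : R) : (x ^+ 2 <= r ^+ 2)%R -> (- r <= x <= r)%R.
    move=> xr; rewrite -ler_norml -(@ler_pXn2r _ 2) ?nnegrE//.
      by rewrite real_normK ?num_real.
    exact: le_trans r0.
  by rewrite !in_itv /= !norm_le.
Qed.

(** For m > 0, the part of the ball that [sphere_proj] sends to the sphere. *)
Let punctured_ball n (m : R) : set (n.-tuple R[i]) :=
  mass_ball n m `&` [set psi | mass psi != 0%R].

Let measurable_punctured_ball n m : measurable (@punctured_ball n m).
Proof.
apply: measurableI; first exact: measurable_mass_ball.
rewrite (_ : mkset _ = ~` (@mass R n @^-1` [set 0%R])); last first.
  by apply/seteqP; split => psi /= /eqP.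
apply: measurableC; rewrite -[X in measurable X]setTI.
exact: measurable_mass.
Qed.

Lemma punctured_mass_ball_gt0 n (m : R) : (0 < n)%N -> (0 < m)%R ->
  0 < vol n (@punctured_ball n m).
Proof.
(* If all real and imaginary parts lie in [r / 2, r], then each |psi(x)|^2 is positive and at most 2
   r^2 = m; this cube is inside the punctured ball. *)
move=> n0 m0; pose r := Num.sqrt (m / 2).
have r0 : (0 < r)%R by rewrite sqrtr_gt0 divr_gt0.
have r2 : (r ^+ 2 = m / 2)%R by rewrite sqr_sqrtr// divr_ge0 ?ltW.
have rr : (r / 2 <= r)%R by lra.
apply: (@lt_le_trans _ _ ((r - r / 2) ^+ 2 ^+ n)%:E).
  by rewrite lte_fin !exprn_gt0//; lra.
rewrite -tuple_measure_cube//; apply: le_measure; rewrite ?inE.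
- exact: measurable_tuple_pred.
- exact: measurable_punctured_ball.
- move=> psi /= h.
  have {}h i : (0 < normc (tnth psi i) ^+ 2 <= m)%R.
    have := h i; rewrite normc_sqr /square /complex_pair; case: (tnth psi i) => a b /=.
    rewrite !in_itv /= => -[/andP[a1 a2] /andP[b1 b2]].
    have a2' : (a ^+ 2 <= r ^+ 2)%R by rewrite ler_pXn2r ?nnegrE//; lra.
    have b2' : (b ^+ 2 <= r ^+ 2)%R by rewrite ler_pXn2r ?nnegrE//; lra.
    apply/andP; split; last by lra.
    by rewrite ltr_wpDr ?sqr_ge0// exprn_gt0//; lra.
  have n0' : (0 < n%:R :> R)%R by rewrite ltr0n.
  split.
    rewrite /mass_ball /= /mass ler_pdivrMl//.
    rewrite -[leRHS](_ : (\sum_(x < n) m)%R = _); last first.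
      by rewrite sumr_const card_ord mulr_natl.
    by apply: ler_sum => i _; have /andP[] := h i.
  rewrite /= /mass mulf_neq0 ?invr_neq0 ?gt_eqF// (bigD1 (Ordinal n0))//=.
  have /andP[h0 _] := h (Ordinal n0).
  by rewrite ltr_pwDl// sumr_ge0// => i _; exact: sqr_ge0.
Qed.

(** The volume of the ball is positive and finite, so [mnormalize] does not fall back on its default
    Dirac mass. *)
Lemma uniform_ballE n (m : R) (A : set (n.-tuple R[i])) :
  (0 < n)%N -> (0 < m)%R ->
  uniform_ball n m A =
  vol n (A `&` mass_ball n m) * (fine (vol n (mass_ball n m)))^-1%:E.
Proof.
move=> n0 m0; rewrite /uniform_ball /mnormalize /= /mnormalize /= /mrestr setTI.
have := punctured_mass_ball_gt0 n0 m0; have := mass_ball_lty n m.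
move=> /lt_eqF -> h; rewrite ifF// orbF.
apply/negbTE; rewrite gt_eqF//; apply: (lt_le_trans h).
apply: le_measure; rewrite ?inE; last exact: subIsetl.
  exact: measurable_punctured_ball.
exact: measurable_mass_ball.
Qed.

Lemma uniform_sphereE n (m : R) (A : set (n.-tuple R[i])) :
  (0 < n)%N -> (0 < m)%R ->
  uniform_sphere n m A = vol n (sphere_proj m @^-1` A `&` mass_ball n m) *
    (fine (vol n (mass_ball n m)))^-1%:E.
Proof. by move=> n0 m0; exact: uniform_ballE. Qed.

Lemma measurable_sphere_preimage n (m : R) (A : set (n.-tuple R[i])) :
  measurable A ->
  measurable (sphere_proj m @^-1` A `&` mass_ball n m).
Proof.
move=> mA; apply: measurableI; last exact: measurable_mass_ball.
by rewrite -[X in measurable X]setTI; exact: measurable_funP.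
Qed.

(** Both sides are volumes of cones in the ball with a common normalization. The cone over [A] lies
    in the preimage of the cone over [B] under the affine map, and the volume of that preimage
    scales exactly. *)
Lemma uniform_sphere_le n (m s : R) (a : n.-tuple R[i])
    (A B : set (n.-tuple R[i])) :
  (0 < n)%N -> (0 < m)%R -> (0 < s)%R -> measurable A -> measurable B ->
  (forall psi, (mass psi <= m)%R -> A (sphere_proj m psi) ->
    (mass (tuple_affine s a psi) <= m)%R /\
    B (sphere_proj m (tuple_affine s a psi))) ->
  uniform_sphere n m A <= ((s^-1 * s^-1) ^+ n)%:E * uniform_sphere n m B.
Proof.
move=> n0 m0 s0 mA mB AB; rewrite !uniform_sphereE// muleA lee_wpmul2r//.
  by rewrite lee_fin invr_ge0 fine_ge0.
rewrite -(lebesgue_preimage_affine a s0)//;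
  last exact: measurable_sphere_preimage.
apply: le_measure; rewrite ?inE; first exact: measurable_sphere_preimage.
  rewrite -[X in measurable X]setTI; apply: measurable_tuple_affine => //.
  exact: measurable_sphere_preimage.
by move=> psi /= [Apsi psim]; have [] := AB _ psim Apsi.
Qed.

Lemma measurable_mass_sphere n (m : R) : measurable (@mass_sphere R n m).
Proof.
rewrite (_ : mass_sphere n m = @mass R n @^-1` [set m])//.
by rewrite -[X in measurable X]setTI; exact: measurable_mass.
Qed.

Lemma uniform_sphere_gt0 n (m : R) : (0 < n)%N -> (0 < m)%R ->
  0 < uniform_sphere n m (mass_sphere n m).
Proof.
move=> n0 m0; rewrite uniform_sphereE//.
have h := punctured_mass_ball_gt0 n0 m0.
have hle : vol n (@punctured_ball n m) <=
    vol n (sphere_proj m @^-1` mass_sphere n m `&` mass_ball n m).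
  apply: le_measure; rewrite ?inE.
  - exact: measurable_punctured_ball.
  - by apply: measurable_sphere_preimage; exact: measurable_mass_sphere.
  - by move=> psi /= [psim psi0]; split=> //; exact: sphere_projP.
rewrite mule_gt0//; first exact: lt_le_trans hle.
rewrite lte_fin invr_gt0 fine_gt0// mass_ball_lty andbT.
apply: (lt_le_trans h); apply: le_measure; rewrite ?inE; last exact: subIsetl.
  exact: measurable_punctured_ball.
exact: measurable_mass_ball.
Qed.

Lemma measurable_tnthB n (x y : 'I_n) :
  measurable_fun setT (fun psi : n.-tuple R[i] => (tnth psi x - tnth psi y)%R).
Proof.
have mp z : measurable_fun setT
    (fun psi : n.-tuple R[i] => complex_pair (tnth psi z)).
  apply: measurableT_comp; first exact: measurable_complex_pair.
  exact: measurable_tnth.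
rewrite (_ : (fun psi => _) = @pair_complex R \o (fun psi : n.-tuple R[i] =>
  (((complex_pair (tnth psi x)).1 - (complex_pair (tnth psi y)).1)%R,
   ((complex_pair (tnth psi x)).2 - (complex_pair (tnth psi y)).2)%R)));
  last first.
  by apply/funext => psi /=; case: (tnth psi x) => a b; case: (tnth psi y).
apply: measurableT_comp; first exact: measurable_pair_complex.
apply: measurable_fun_pair; apply: measurable_funB.
- exact: (measurableT_comp measurable_fst (mp x)).
- exact: (measurableT_comp measurable_fst (mp y)).
- exact: (measurableT_comp measurable_snd (mp x)).
- exact: (measurableT_comp measurable_snd (mp y)).
Qed.

Lemma measurable_hamiltonian n : measurable_fun setT (@hamiltonian R n).
Proof.
apply: measurable_funB; apply: measurable_funM => //;
  apply: measurable_sum => x.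
  apply: measurable_funM => //; apply: measurable_funX.
  by apply: measurableT_comp; [exact: measurable_normc|exact: measurable_tnthB].
apply: measurable_funX.
by apply: measurableT_comp; [exact: measurable_normc|exact: measurable_tnth].
Qed.

End volume.

(** * Concentration of a Gibbs weight on a probability space, from a comparison of level sets *)

Section gibbs_concentration.
Set Implicit Arguments.
Unset Strict Implicit.
Local Open Scope ereal_scope.
Context d (T : measurableType d) (R : realType) (P : probability T R).
Variables (S : set T) (H : T -> R) (b E0 eps : R) (N : nat) (D : nat -> R).
Hypotheses (mS : measurable S) (mH : measurable_fun setT H).
Hypothesis b0 : (0 <= b)%R.
Hypothesis H_ge : forall x, S x -> (E0 <= H x)%R.
Hypothesis H_le : forall x, S x -> (H x <= E0 + eps + N%:R)%R.

Let level E := S `&` [set x | (H x <= E)%R].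
Let weight x := (expR (- b * H x))%:E.

Hypothesis S_gt0 : 0 < P S.
Hypothesis D_ge0 : forall k, (0 <= D k)%R.
Hypothesis level_le : forall k,
  P (level (E0 + eps + k.+1%:R)%R) <= (D k)%:E * P (level (E0 + eps / 2)%R).

Let measurable_level E : measurable (level E).
Proof.
apply: measurableI => //; rewrite -[X in measurable X]setTI.
rewrite (_ : [set x | _] = H @^-1` `]-oo, E]%classic); first exact: mH.
by apply/seteqP; split => x /=; rewrite in_itv.
Qed.

Let measurable_weight A : measurable_fun A weight.
Proof.
apply: (@measurable_funS _ _ _ _ setT) => //.
apply/measurable_EFinP; apply: measurableT_comp; first exact: measurable_expR.
by apply: measurable_funM.
Qed.

Let weight_ge0 x : 0 <= weight x. Proof. by rewrite lee_fin expR_ge0. Qed.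

Let Z := \int[P]_(x in S) weight x.

(** Otherwise [level_le] at [k = N] would make all of [S] null, since H <= E0 + eps + N there. *)
Let level_gt0 : 0 < P (level (E0 + eps / 2)%R).
Proof.
rewrite lt0e measure_ge0 andbT; apply/negP => /eqP P0.
have := level_le N; rewrite P0 mule0; apply/negP; rewrite -ltNge.
apply: (lt_le_trans S_gt0); apply: le_measure; rewrite ?inE//.
move=> x Sx; split=> //=; apply: (le_trans (H_le Sx)).
by rewrite lerD2l ler_nat.
Qed.

(** Only energies up to E0 + eps / 2 are kept; the weight is smallest at the top of that range. *)
Let Z_ge : (expR (- b * (E0 + eps / 2)))%:E * P (level (E0 + eps / 2)%R) <= Z.
Proof.
rewrite -integral_cst//.
apply: (@le_trans _ _ (\int[P]_(x in level (E0 + eps / 2)%R) weight x)).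
  apply: ge0_le_integral => //; first by move=> x _; rewrite lee_fin expR_ge0.
  by move=> x [_ /= Hx]; rewrite lee_fin ler_expR !mulNr lerN2 ler_wpM2l.
by apply: ge0_subset_integral => // x [].
Qed.

Let Z_gt0 : 0 < Z.
Proof. by apply: lt_le_trans Z_ge; rewrite mule_gt0// lte_fin expR_gt0. Qed.

Let Z_lty : Z < +oo.
Proof.
apply: (@le_lt_trans _ _ (\int[P]_(x in S) cst (expR (- b * E0))%:E x)).
  apply: ge0_le_integral => // x Sx.
  by rewrite lee_fin ler_expR !mulNr lerN2 ler_wpM2l// H_ge.
rewrite integral_cst//.
rewrite (@le_lt_trans _ _ ((expR (- b * E0))%:E * 1)) ?mule1 ?ltry//.
by rewrite -[leRHS]mule1 lee_wpmul2l ?probability_le1// lee_fin expR_ge0.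
Qed.

Let above := S `&` ~` [set x | (H x <= E0 + eps)%R].

Let tail := \int[P]_(x in above) weight x.

Let measurable_above : measurable above.
Proof.
rewrite (_ : above = S `\` level (E0 + eps)%R); first exact: measurableD.
by apply/seteqP; split => x /= [Sx Hx]; split=> // h; apply: Hx;
  [case: h|split].
Qed.

(** Where H lies between E0 + eps + k and E0 + eps + k + 1 the weight is at most [c k], so on
    [above] it is at most the sum of the [c k] times the indicators of the whole levels [B k]. Then
    [level_le] and [Z_ge] compare each summand with Z. *)
Let tail_le :
  tail <= (\sum_(k < N) expR (- b * (eps / 2 + k%:R)) * D k)%:E * Z.
Proof.
pose c k := (expR (- b * (E0 + eps + k%:R)))%R.
pose B k := level (E0 + eps + k.+1%:R)%R.
pose f (k : 'I_N) x := (c k)%:E * (\1_(B k) x)%:E.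
have f0 k x : 0 <= f k x by rewrite mule_ge0// lee_fin ?expR_ge0.
have mf k : measurable_fun setT (f k).
  apply: measurable_funeM; apply/measurable_EFinP.
  exact: (measurable_indic (measurable_level _)).
apply: (@le_trans _ _ (\int[P]_x \sum_(k < N) f k x)).
  apply: (@le_trans _ _ (\int[P]_(x in above) \sum_(k < N) f k x)).
    apply: ge0_le_integral => //.
      by apply: emeasurable_sum => k; apply: measurable_funTS.
    move=> x [Sx /negP]; rewrite -ltNge => Hx.
    have HxN := H_le Sx.
    pose y := (H x - (E0 + eps))%R.
    have y0 : (0 < y)%R by rewrite subr_gt0.
    have ex : exists k, (y <= k.+1%:R)%R.
      by exists N; apply: (@le_trans _ _ N%:R); [|by rewrite ler_nat];
        rewrite /y; lra.
    (* The least [k] with y <= k + 1: minimality gives k <= y, and also k < N because y <= N. *)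
    pose k := ex_minn ex.
    have [yk kmin] : (y <= k.+1%:R)%R /\
        forall j, (y <= j.+1%:R)%R -> (k <= j)%N.
      by rewrite /k; case: ex_minnP.
    have N0 : (0 < N)%N.
      rewrite lt0n; apply/eqP => N0; move: HxN Hx; rewrite N0 addr0 => ?.
      by rewrite ltNge => /negP.
    have kN : (k < N)%N.
      rewrite -(prednK N0) ltnS; apply: kmin; rewrite (prednK N0) /y; lra.
    have ky : (k%:R <= y)%R.
      case E : k => [|j]; first by rewrite ltW.
      rewrite leNgt; apply/negP => yj.
      by have := kmin j (ltW yj); rewrite E ltnn.
    rewrite (bigD1 (Ordinal kN))//=; apply: (@le_trans _ _ (f (Ordinal kN) x)).
      rewrite /f indicE mem_set ?mule1; last first.
        by split=> //=; move: yk; rewrite /y; lra.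
      rewrite lee_fin ler_expR !mulNr lerN2 ler_wpM2l//=.
      by move: ky; rewrite /y; lra.
    by rewrite leeDl// sume_ge0.
  apply: ge0_subset_integral => //; first exact: emeasurable_sum.
  by move=> x _; rewrite sume_ge0.
rewrite ge0_integral_sum// -sumEFin ge0_sume_distrl; last first.
  by move=> k _; rewrite lee_fin mulr_ge0// expR_ge0.
apply: lee_sum => k _; rewrite ge0_integralZl//; last 2 first.
- by apply/measurable_EFinP; exact: (measurable_indic (measurable_level _)).
- by rewrite lee_fin expR_ge0.
rewrite (integral_indic P measurableT (measurable_level _)) setIT.
apply: (@le_trans _ _ ((c k)%:E * ((D k)%:E * P (level (E0 + eps / 2)%R)))).
  by rewrite lee_wpmul2l ?lee_fin ?expR_ge0//; exact: level_le.
(* The exponent splits as E0 + eps + k = (eps / 2 + k) + (E0 + eps / 2), and [Z_ge] absorbs the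
   second part. *)
apply: (@le_trans _ _ ((expR (- b * (eps / 2 + k%:R)) * D k)%:E *
   ((expR (- b * (E0 + eps / 2)))%:E * P (level (E0 + eps / 2)%R)))).
  rewrite !muleA -!EFinM le_eqVlt; apply/orP; left; apply/eqP; congr (_%:E * _).
  rewrite mulrAC -expRD; congr (expR _ * _)%R; lra.
by rewrite lee_wpmul2l// lee_fin mulr_ge0// expR_ge0.
Qed.

(** Z is the integral over the low energies plus [tail], and [tail_le] bounds the share of the
    latter in Z, which is positive and finite. *)
Lemma gibbs_concentration :
  (1 - \sum_(k < N) expR (- b * (eps / 2 + k%:R)) * D k)%:E <=
  (\int[P]_(x in S) weight x)^-1 *
    \int[P]_(x in S `&` [set x | (H x <= E0 + eps)%R]) weight x <= 1.
Proof.
rewrite -/Z; set I := \int[P]_(x in level _) _.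
have ZE : Z = I + tail.
  rewrite /Z /I /tail -ge0_integral_setU//.
  - by rewrite -setIUr setUv setIT.
  - by apply/disj_set2P; rewrite setIACA setICr setI0.
have I0 : 0 <= I by exact: integral_ge0.
have t0 : 0 <= tail by exact: integral_ge0.
have := tail_le; have := Z_gt0; have := Z_lty; rewrite ZE.
case: I I0 {ZE} => [x||]//; case: tail t0 => [y||]// y0 x0.
rewrite -!EFinD => _; rewrite lte_fin -EFinM lee_fin inver => xy0.
rewrite gt_eqF// -EFinM !lee_fin [(_^-1 * _)%R]mulrC.
rewrite ler_pdivlMr// ler_pdivrMr//.
move: (\sum_(k < N) _)%R => s ys; rewrite !lee_fin in x0 y0.
by apply/andP; split; lra.
Qed.

End gibbs_concentration.

(** * Comparison of energy levels of the sphere, uniformly in n *)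

Section energy_levels.
Set Implicit Arguments.
Unset Strict Implicit.
Context {R : realType}.

Lemma measurable_energy_level n (m E : R) :
  measurable (mass_sphere n m `&` [set psi | hamiltonian psi <= E]).
Proof.
apply: measurableI; first exact: measurable_mass_sphere.
rewrite -[X in measurable X]setTI.
rewrite (_ : [set psi | _] = @hamiltonian R n @^-1` `]-oo, E]%classic).
  exact: measurable_hamiltonian.
by apply/seteqP; split => psi /=; rewrite in_itv.
Qed.

(** As m / 0 = 0, a tuple of mass 0 is projected to the zero tuple, which is off the sphere. *)
Lemma mass_neq0_sphere_proj n (m : R) (psi : n.-tuple R[i]) : 0 < m ->
  mass_sphere n m (sphere_proj m psi) -> mass psi != 0.
Proof.
move=> m0; apply: contraPN => /eqP psi0; rewrite /mass_sphere /= => h.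
move: m0; rewrite -h /mass.
rewrite big1 ?mulr0 ?ltxx// => x _.
by rewrite tnth_mktuple psi0 invr0 mulr0 sqrtr0 normc_sqrM expr0n mul0r.
Qed.

(** One [c] serves all [n] because the ground energies are at most 0: this bounds the kinetic energy
    and then the sup norm of an almost minimizer in terms of [m] and [eps]. *)
Lemma uniform_sphere_level_le (m eps : R) : 0 < m -> 0 < eps ->
  exists2 c : R, 0 < c & forall n k, (0 < n)%N ->
  (uniform_sphere n m (mass_sphere n m `&`
     [set psi | (hamiltonian psi <= ground_energy n m + eps + k.+1%:R)%R]) <=
   ((k.+1%:R / c * (k.+1%:R / c)) ^+ n)%:E *
   uniform_sphere n m (mass_sphere n m `&`
     [set psi | (hamiltonian psi <= ground_energy n m + eps / 2)%R]))%E.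
Proof.
move=> m0 eps0.
(* [C0] is the constant of [kinetic_le_hamiltonian], [Ka] bounds the kinetic energy of the almost
   minimizer [a], [B] bounds |a(x)|^2 (pointwise bound with t = 1), and D (k + 1) bounds the factor
   of [s] in [hamiltonian_homothety]. *)
pose C0 := m ^+ 2 / 2 + 2 * m ^+ 3.
have C00 : 0 < C0 by rewrite addr_gt0 ?mulr_gt0 ?exprn_gt0.
pose Ka := eps / 2 + C0.
pose B := 5 * m + 2 * Ka.
pose D := 8 * Ka + 4 * eps + 4 + 2 * C0 + 2 * B * m.
have Ka0 : 0 < Ka by rewrite /Ka; lra.
have B0 : 0 < B by rewrite /B; lra.
have Bm0 : 0 < B * m by rewrite mulr_gt0.
have D0 : 0 < D by rewrite /D; lra.
(* The first entry allows the contraction estimate; the second keeps the energy increase below eps /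
   4, which adds up to eps / 2 with the eps / 4 by which [a] misses the infimum. *)
pose c := Num.min 8^-1 (eps / (4 * D)).
have c0 : 0 < c by rewrite lt_min invr_gt0 ltr0n/= divr_gt0// mulr_gt0.
exists c => // n k n0.
have k0 : 0 < k.+1%:R :> R by rewrite ltr0n.
pose s := c / k.+1%:R; have s0 : 0 < s by rewrite divr_gt0.
have s8 : s <= 8^-1.
  rewrite ler_pdivrMr// (@le_trans _ _ 8^-1)//; first by rewrite ge_min lexx.
  by rewrite ler_peMr// ler1n.
have sD : s * (D * k.+1%:R) <= eps / 4.
  have -> : s * (D * k.+1%:R) = c * D by rewrite /s; field; rewrite gt_eqF.
  have : c <= eps / (4 * D) by rewrite ge_min lexx orbT.
  by rewrite ler_pdivlMr ?mulr_gt0//; lra.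
have [a am aH] := ground_energy_adherent n0 m0 (divr_gt0 eps0 (ltr0n R 4)).
have E0 := ground_energy_le0 n0 m0.
have aK : kinetic a <= Ka.
  by have := kinetic_le_hamiltonian m0 am; rewrite /Ka /C0; lra.
have aB x : normc (tnth a x) ^+ 2 <= B.
  have := normc_sqr_le a x ltr01; rewrite am /B; lra.
rewrite -invf_div -/s.
apply: (@uniform_sphere_le _ n m s
  [tuple (1 - s)%:C%C * tnth a x | x < n]) => //.
- exact: measurable_energy_level.
- exact: measurable_energy_level.
move=> psi psim [/= psiS psiH]; rewrite -/(homothety s a psi).
have psi0 := mass_neq0_sphere_proj m0 psiS.
have Kpsi : kinetic psi <= 2 * (eps + k.+1%:R) + C0.
  apply: (le_trans (kinetic_le_sphere_proj m0 psi0 psim)).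
  by have := kinetic_le_hamiltonian m0 psiS; rewrite /C0; lra.
have [|h1 h2 h3] := hamiltonian_homothety m0 _ am psim aB (s := s).
  by rewrite s8 ltW.
split=> //; split=> /=; first exact: sphere_projP.
apply: (le_trans h3); rewrite -/B.
have : s * (8 * kinetic a + 2 * kinetic psi + 2 * B * m) <= s * (D * k.+1%:R).
  rewrite ler_pM2l//.
  (* The 4 in [D] is set apart: it comes from the kinetic bound on [psi], where it already
     multiplies k + 1. *)
  have : (D - 4) * 1 <= (D - 4) * k.+1%:R.
    by rewrite ler_wpM2l ?ler1n//; rewrite /D; lra.
  rewrite /D; lra.
lra.
Qed.

End energy_levels.

(** * The limit: summing the level bounds once b / n is large *)

Theorem theorem5p1 (R : realType) (m beta : R) (theta : nat -> R)
    (m_gt0 : 0 < m) (beta_gt0 : 0 < beta)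
    (theta_gt0 : forall n, (0 < n)%N -> 0 < theta n)
    (theta_lim : theta n / n%:R @[n --> \oo] --> +oo) (eps : R)
    (eps_gt0 : 0 < eps) :
  gibbs n (theta n * beta) m
      [set psi : n.-tuple R[i] | hamiltonian psi <= ground_energy n m + eps]
    @[n --> \oo] --> 1%E.
Proof.
have [c c0 levels] := uniform_sphere_level_le m_gt0 eps_gt0.
pose L := ln c^-1.
(* Once b >= A n, the entry 3 beats the factor exp(2 n k) bounding (k + 1)^(2n), and the other entry
   gives b eps / 2 >= (2 L + 1) n, which beats c^(-2n) = exp(2 n L) and leaves exp(- n). *)
pose A := Num.max 3 (2 / eps * (2 * L + 1)).
(* [harmonic n] is 1 / (n + 1), which dominates exp(- n); the 2 is the sum of a geometric series. *)
apply: (@squeeze_cvge _ _ _ _ (fun n => (1 - 2 * harmonic n)%:E) _ (cst 1%E)).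
- near=> n.
  have n0 : (0 < n)%N by near: n; exists 1%N.
  have n0' : 0 < n%:R :> R by rewrite ltr0n.
  have : A / beta <= theta n / n%:R by near: n; exact: (cvgryPge _).1.
  rewrite ler_pdivlMr// mulrAC ler_pdivrMr// => bA.
  have b3 : 3 * n%:R <= theta n * beta.
    by apply: le_trans bA; rewrite ler_pM2r// le_max lexx.
  have bL : (2 * L + 1) * n%:R <= theta n * beta * (eps / 2).
    apply: (@le_trans _ _ (A * n%:R * (eps / 2))); last first.
      by rewrite ler_pM2r// divr_gt0.
    rewrite mulrAC ler_pM2r// -ler_pdivrMr ?divr_gt0// invf_div mulrC.
    by rewrite le_max lexx orbT.
  (* On the sphere H <= K <= 2 n^2 m. The number [N] of levels depends on [n], but the bound on the
     sum below does not depend on [N]. *)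
  have [N HN] : exists N : nat, forall psi, mass_sphere n m psi ->
      hamiltonian psi <= ground_energy n m + eps + N%:R.
    pose x := 2 * n%:R ^+ 2 * m - (ground_energy n m + eps).
    exists (Num.bound `|x|) => psi psim.
    have := archi_boundP (normr_ge0 x); have := ler_norm x.
    have := kinetic_le psi n0; have := quartic_ge0 psi.
    by rewrite hamiltonianE psim /x; lra.
  have b0 : 0 <= theta n * beta by rewrite mulr_ge0// ltW// theta_gt0.
  have D_ge0 k : 0 <= (k.+1%:R / c * (k.+1%:R / c)) ^+ n.
    by rewrite exprn_ge0// mulr_ge0// divr_ge0// ltW.
  have /andP[lo ->] := gibbs_concentration
    (@measurable_mass_sphere R n m) (@measurable_hamiltonian R n) b0
    (fun psi => ground_energy_le n0 m_gt0) HN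
    (uniform_sphere_gt0 n0 m_gt0) D_ge0 (fun k => levels n k n0).
  rewrite andbT; apply: le_trans lo; rewrite lee_fin lerD2l lerN2.
  apply: (@le_trans _ _ (\sum_(k < N) expR (- n%:R) * 2^-1 ^+ k)).
    apply: ler_sum => k _.
    have kL : k.+1%:R / c <= expR (k%:R + L).
      rewrite expRD lnK ?posrE ?invr_gt0// ler_pM2r ?invr_gt0// -natr1 addrC.
      exact: expR_ge1Dx.
    have k2 : expR (- k%:R) <= 2^-1 ^+ k :> R.
      rewrite expRN exprVn lef_pV2 ?posrE ?expR_gt0 ?exprn_gt0//.
      rewrite -[k%:R]mulr1 expRM_natl lerXn2r ?nnegrE ?expR_ge0//.
      by have := expR_ge1Dx (1 : R); lra.
    apply: (@le_trans _ _ (expR (- n%:R) * expR (- k%:R))); last first.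
      by rewrite ler_pM2l// expR_gt0.
    apply: (@le_trans _ _ (expR (- (theta n * beta) * (eps / 2 + k%:R)) *
        expR (n%:R * ((k%:R + L) + (k%:R + L))))).
      rewrite ler_pM2l ?expR_gt0// expRM_natl expRD.
      have kc0 : 0 <= k.+1%:R / c by rewrite divr_ge0// ltW.
      apply: lerXn2r; last exact: ler_pM.
        by rewrite nnegrE mulr_ge0.
      by rewrite nnegrE mulr_ge0 ?expR_ge0.
    (* The exponent is at most - (2 L + 1) n - 3 n k + 2 n (k + L) = - n - n k, hence at most - n -
       k. *)
    rewrite -!expRD ler_expR.
    have : 3 * n%:R * k%:R <= theta n * beta * k%:R by rewrite ler_wpM2r.
    have : k%:R <= n%:R * k%:R :> R by rewrite ler_peMl// ler1n.
    lra.
  have geo M : \sum_(k < M) 2^-1 ^+ k = 2 - 2 * 2^-1 ^+ M :> R.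
    by elim: M => [|M IHM]; rewrite ?big_ord0 ?big_ord_recr/= ?IHM ?exprS; lra.
  rewrite -mulr_sumr geo mulrC ler_pM ?expR_ge0//.
  - by rewrite subr_ge0 ler_piMr// exprn_ile1// invf_le1// ler1n.
  - by rewrite gerBl mulr_ge0// exprn_ge0// invr_ge0.
  rewrite expRN /= lef_pV2 ?posrE ?expR_gt0// -natr1 addrC.
  exact: expR_ge1Dx.
- apply: cvg_EFin; first by near=> n.
  rewrite -[X in _ --> X]subr0 -[X in _ - X](mulr0 2).
  apply: cvgB; first exact: cvg_cst.
  by apply: cvgM; [exact: cvg_cst|exact: cvg_harmonic].
- exact: cvg_cst.
Unshelve. all: by end_near.
Qed.
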